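(* Let $F_T:\widehat T\to T\subset\mathbb R^3$ be a regular parameterization of a curved triangle on a smooth oriented surface, $J=DF_T$, $G=J^TJ$, $J_\Gamma=\sqrt{\det G}$. If a tangent field $w$ on $T$ and a field $\hat w:\widehat T\to\mathbb R^2$ are related by the contravariant Piola map $w\circ F_T=J_\Gamma^{-1}J\hat w$, then on every edge the co-normal flux density of $w$ times the physical line measure equals the normal flux density of $\hat w$ times the reference line measure: for an edge $\hat e\subset\partial\widehat T$ parameterized by $\hat\gamma$, with $e=F_T(\hat e)$, $$(w\cdot\mu)\,\mathrm ds=(\hat w\cdot\hat\nu)\,\mathrm d\hat t .$$ Hence, on a conforming curved triangulation, the reference normal functionals enforce $H(\mathrm{div}_\Gamma)$ conformity on the surface.
   Context: $\widehat T\subset\mathbb R^2$ is the reference triangle; a regular map is a smooth injective map with $J=[J_1\ J_2]\in\mathbb R^{3\times2}$ of full rank. $N=(J_1\times J_2)/J_\Gamma$ is the unit normal, and the element maps are oriented so that $N$ is the orientation normal. Put $\hat\tau=\hat\gamma'$ and $\hat\nu=R\hat\tau$ with $R(a_1,a_2)=(-a_2,a_1)$ (so $\hat\nu\,\mathrm d\hat t$ is the unit normal times the reference line measure). The physical co-normal line vector is $\mu\,\mathrm ds=N\times J\hat\tau\,\mathrm d\hat t$, where $\mu$ is the unit co-normal and $\mathrm ds$ the arc length on $e$. Conforming curved triangulation: for two curved triangles sharing an edge $e$, with element maps $F_\pm$, there are affine parameterizations $\hat\gamma_\pm:[0,1]\to\hat e_\pm$ of the corresponding reference edges with $F_+\circ\hat\gamma_+=F_-\circ\hat\gamma_-$.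 The reference normal functionals on $e$ are the differences of the univariate Bernstein coefficients (in the basis $\binom djt^j(1-t)^{d-j}$) of $t\mapsto\hat w_\pm(\hat\gamma_\pm(t))\cdot R\hat\gamma_\pm'(t)$ for polynomial reference fields $\hat w_\pm\in[\mathcal P_d(\widehat T)]^2$. The piecewise mapped field is $H(\mathrm{div}_\Gamma)$-conforming if its co-normal flux (with respect to co-normals $\mu$ obtained from a common direction of travel along $e$) is single-valued across every shared edge; the claim is that vanishing of all reference normal functionals guarantees this. *)

(* Defs.v *)
From HB Require Import structures.
From mathcomp Require Import all_boot all_order all_algebra.
From mathcomp Require Import all_classical all_reals all_analysis.

Set Implicit Arguments.
Unset Strict Implicit.
Unset Printing Implicit Defensive.

Import Order.TTheory GRing.Theory Num.Theory.
Import numFieldNormedType.Exports.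

Local Open Scope classical_set_scope.
Local Open Scope ring_scope.

(* Points and vectors of R^n are row vectors, so the library's jacobian
   ['J F x] is the transpose of the 3 x 2 matrix J = DF(x): its rows are the
   columns J_1, J_2 of J, and J v is [v *m 'J F x]. *)

Section Defs.
Context {R : realType}.

(* The library norm on matrices is the sup norm, hence these definitions. *)
Definition dot n (u v : 'rV[R]_n) : R := (u *m v^T) 0 0.
Definition enorm n (v : 'rV[R]_n) : R := Num.sqrt (dot v v).

Definition cross (u v : 'rV[R]_3) : 'rV[R]_3 :=
  \row_k (u 0 (k + 1) * v 0 (k + 2) - u 0 (k + 2) * v 0 (k + 1)).
  (* indices in 'I_3, i.e. modulo 3 *)

Definition rot (v : 'rV[R]_2) : 'rV[R]_2 :=
  \row_k (if k == 0 then - v 0 1 else v 0 0).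

(* C^infinity on an open set [U]: every iterated directional derivative is
   differentiable at every point of [U]. *)
Definition smooth_on (V W : normedModType R) (U : set V) (f : V -> W) : Prop :=
  forall (vs : seq V) x, U x ->
    differentiable (foldr (fun v (g : V -> W) => 'D_v g) f vs) x.

(* Barycentric coordinates for the vertices (0,0), (1,0), (0,1). *)
Definition bary (x : 'rV[R]_2) (k : 'I_3) : R :=
  [:: 1 - x 0 0 - x 0 1; x 0 0; x 0 1]`_k.

Definition ref_triangle : set 'rV[R]_2 := [set x | forall k, 0 <= bary x k].
Definition ref_vertex (k : 'I_3) : set 'rV[R]_2 :=
  [set x | ref_triangle x /\ bary x k = 1].
(* Edge [k] is opposite to vertex [k]. *)
Definition ref_edge (k : 'I_3) : set 'rV[R]_2 :=
  [set x | ref_triangle x /\ bary x k = 0].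

Definition regular_param n (g : R -> 'rV[R]_n) (E : set 'rV[R]_n) : Prop :=
  [/\ set_bij `[0, 1] E g,
      forall t, 0 <= t <= 1 -> derivable g t 1 /\ derive1 g t != 0 &
      {within `[0, 1], continuous (derive1 g)}].

Definition affine_param n (g : R -> 'rV[R]_n) (E : set 'rV[R]_n) : Prop :=
  (exists p v, forall t, g t = p + t *: v) /\ g @` `[0, 1] = E.

Definition smooth_surface (Gamma : set 'rV[R]_3) : Prop :=
  forall p, Gamma p -> exists (U : set 'rV[R]_3) (phi : 'rV[R]_3 -> R),
    [/\ open U, U p, smooth_on U phi &
        forall x, U x -> (Gamma x <-> phi x = 0) /\ (exists v, 'D_v phi x != 0)].

Definition tangent_vector (Gamma : set 'rV[R]_3) (p v : 'rV[R]_3) : Prop :=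
  exists c : R -> 'rV[R]_3,
    [/\ c 0 = p, \forall t \near (0 : R), Gamma (c t),
        derivable c 0 1 & derive1 c 0 = v].

Definition tangent_field (Gamma T : set 'rV[R]_3) (w : 'rV[R]_3 -> 'rV[R]_3) :=
  forall p, T p -> tangent_vector Gamma p (w p).

Definition orientation_normal (Gamma : set 'rV[R]_3) (n : 'rV[R]_3 -> 'rV[R]_3) :
    Prop :=
  {within Gamma, continuous n} /\
  forall p, Gamma p ->
    enorm (n p) = 1 /\ (forall v, tangent_vector Gamma p v -> dot (n p) v = 0).

(* Smoothness up to the boundary of the closed triangle is smoothness on an
   open neighbourhood; the values of F away from the triangle are irrelevant,
   since the jacobian on the triangle only depends on F there. *)
Definition regular_map (F : 'rV[R]_2 -> 'rV[R]_3) : Prop :=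
  [/\ exists2 U, open U & ref_triangle `<=` U /\ smooth_on U F,
      set_inj ref_triangle F &
      forall x, ref_triangle x -> \rank ('J F x) = 2%N].

(* G = J^T J *)
Definition metric (F : 'rV[R]_2 -> 'rV[R]_3) x : 'M[R]_2 :=
  'J F x *m ('J F x)^T.
Definition area_density (F : 'rV[R]_2 -> 'rV[R]_3) x : R :=
  Num.sqrt (\det (metric F x)).

Definition unit_normal (F : 'rV[R]_2 -> 'rV[R]_3) x : 'rV[R]_3 :=
  (area_density F x)^-1 *: cross (row 0 ('J F x)) (row 1 ('J F x)).

Definition curved_triangle (Gamma : set 'rV[R]_3) (n : 'rV[R]_3 -> 'rV[R]_3)
    (F : 'rV[R]_2 -> 'rV[R]_3) : Prop :=
  [/\ regular_map F, F @` ref_triangle `<=` Gamma &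
      forall x, ref_triangle x -> unit_normal F x = n (F x)].

(* w o F = J_Gamma^-1 J what *)
Definition piola (F : 'rV[R]_2 -> 'rV[R]_3) (what : 'rV[R]_2 -> 'rV[R]_2)
    (w : 'rV[R]_3 -> 'rV[R]_3) : Prop :=
  forall x, ref_triangle x ->
    w (F x) = (area_density F x)^-1 *: (what x *m 'J F x).

(* ds = speed c t dt *)
Definition speed n (c : R -> 'rV[R]_n) (t : R) : R := enorm (derive1 c t).
Definition unit_tangent n (c : R -> 'rV[R]_n) (t : R) : 'rV[R]_n :=
  (speed c t)^-1 *: derive1 c t.
(* mu = N x (unit tangent in the direction of travel of c) *)
Definition conormal (N : 'rV[R]_3) (c : R -> 'rV[R]_3) (t : R) : 'rV[R]_3 :=
  cross N (unit_tangent c t).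

(* nu = R tau, not normalized *)
Definition ref_conormal (g : R -> 'rV[R]_2) (t : R) : 'rV[R]_2 :=
  rot (derive1 g t).

(* [P_d]^2 on the reference triangle, d bounding the total degree *)
Definition poly_field (d : nat) (what : 'rV[R]_2 -> 'rV[R]_2) : Prop :=
  exists a : nat -> nat -> 'rV[R]_2, forall x, ref_triangle x ->
    what x = \sum_(i < d.+1) \sum_(j < d.+1 | (i + j <= d)%N)
               (x 0 0 ^+ i * x 0 1 ^+ j) *: a i j.

Definition bernstein (d j : nat) (t : R) : R :=
  'C(d, j)%:R * t ^+ j * (1 - t) ^+ (d - j).

(* The row of coefficients of [q] in the Bernstein basis of degree [d]
   (arbitrary if [q] is not a polynomial of degree at most [d] on [0,1]). *)
Definition bernstein_coef (d : nat) (q : R -> R) : 'rV[R]_d.+1 :=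
  get [set c : 'rV[R]_d.+1 | forall t, 0 <= t <= 1 ->
    q t = \sum_(j < d.+1) c 0 j * bernstein d j t].

Definition ref_flux (what : 'rV[R]_2 -> 'rV[R]_2) (g : R -> 'rV[R]_2) (t : R) :
    R :=
  dot (what (g t)) (ref_conormal g t).

Definition normal_functional (d : nat)
    (whatp : 'rV[R]_2 -> 'rV[R]_2) (gp : R -> 'rV[R]_2)
    (whatm : 'rV[R]_2 -> 'rV[R]_2) (gm : R -> 'rV[R]_2) (k : 'I_d.+1) : R :=
  bernstein_coef d (ref_flux whatp gp) 0 k -
  bernstein_coef d (ref_flux whatm gm) 0 k.

Section Mesh.
Variables (I : finType) (F : I -> 'rV[R]_2 -> 'rV[R]_3).

(* edge [a] of triangle [i] is edge [b] of the different triangle [j] *)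
Definition shared_edge (i : I) (a : 'I_3) (j : I) (b : 'I_3) : Prop :=
  i <> j /\ F i @` ref_edge a = F j @` ref_edge b.

(* Two distinct triangles meet only in common vertices and common edges, and
   [gp i a j b], [gm i a j b] are the affine parameterizations, matched by the
   element maps, of the two reference edges of the shared edge (i,a,j,b). *)
Definition conforming_triangulation (Gamma : set 'rV[R]_3)
    (n : 'rV[R]_3 -> 'rV[R]_3)
    (gp gm : I -> 'I_3 -> I -> 'I_3 -> R -> 'rV[R]_2) : Prop :=
  [/\ forall i, curved_triangle Gamma n (F i),
      forall i j p, i <> j ->
        (F i @` ref_triangle) p -> (F j @` ref_triangle) p ->
        (exists k l, (F i @` ref_vertex k) p /\ (F j @` ref_vertex l) p) \/
        (exists a b, shared_edge i a j b /\ (F i @` ref_edge a) p) &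
      forall i a j b, shared_edge i a j b ->
        [/\ affine_param (gp i a j b) (ref_edge a),
            affine_param (gm i a j b) (ref_edge b) &
            forall t, 0 <= t <= 1 ->
              F i (gp i a j b t) = F j (gm i a j b t)]].

(* Single-valued co-normal flux across every shared edge, the co-normals on
   the two sides being taken for one common direction of travel, given by an
   arbitrary regular parameterization [c] of the physical edge. *)
Definition hdiv_conforming (w : I -> 'rV[R]_3 -> 'rV[R]_3) : Prop :=
  forall i a j b, shared_edge i a j b ->
  forall c : R -> 'rV[R]_3, regular_param c (F i @` ref_edge a) ->
  forall t x y, 0 <= t <= 1 -> ref_edge a x -> ref_edge b y ->
    F i x = c t -> F j y = c t ->
    dot (w i (c t)) (conormal (unit_normal (F i) x) c t) =
    dot (w j (c t)) (conormal (unit_normal (F j) y) c t).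

End Mesh.
End Defs.

(* Main.v *)
Require Import Defs.
From HB Require Import structures.
From mathcomp Require Import all_boot all_order all_algebra.
From mathcomp Require Import all_classical all_reals all_analysis.
From mathcomp Require Import ring lra.
Import Order.TTheory GRing.Theory Num.Theory.
Import numFieldNormedType.Exports.
Local Open Scope classical_set_scope.
Local Open Scope ring_scope.

(* With J_1, J_2 the columns of J, the triple product
     (J u) . ((J_1 x J_2) x J v) = (u . R v) |J_1 x J_2|^2
   and Lagrange's identity |J_1 x J_2|^2 = det G turn the Piola map into
   equality of the flux densities. For conformity, equal Bernstein coefficients
   give equal reference fluxes along the matched parameterizations of an edge,
   and the normals on both sides are the orientation normal; so the linear form
   v |-> (w_+ - w_-) . (N x v) vanishes on the velocity of F_+ o gamma_+. Since
   any other regular parameterization c of the edge is tangent to this curve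
   (its transition to the parameter of gamma_+ is continuous by compactness of
   [0, 1], though not known to be differentiable), the form vanishes on c'. *)

(** * Cross products and Gram determinants *)

Lemma det_mx22 (R : comNzRingType) (A : 'M[R]_2) :
  \det A = A 0 0 * A 1 1 - A 0 1 * A 1 0.
Proof.
rewrite (expand_det_row _ ord0) !big_ord_recl big_ord0 /cofactor !det_mx11 !mxE.
have -> : lift ord0 ord0 = 1 :> 'I_2 by apply: val_inj.
have -> : lift (1 : 'I_2) ord0 = 0 :> 'I_2 by apply: val_inj.
have -> : ord0 = 0 :> 'I_2 by apply: val_inj.
by rewrite /= expr0 expr1; ring.
Qed.

Section Vectors.
Context {R : realType}.
Implicit Types u v w : 'rV[R]_3.

Lemma dotE n (u v : 'rV[R]_n) : dot u v = \sum_k u 0 k * v 0 k.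
Proof. by rewrite /dot mxE; apply: eq_bigr => k _; rewrite mxE. Qed.

Lemma dotBl n (u v w : 'rV[R]_n) : dot (u - v) w = dot u w - dot v w.
Proof. by rewrite /dot mulmxBl !mxE. Qed.

Lemma dotZr n a (u v : 'rV[R]_n) : dot u (a *: v) = a * dot u v.
Proof. by rewrite /dot linearZ -scalemxAr mxE. Qed.

Lemma dotZl n a (u v : 'rV[R]_n) : dot (a *: u) v = a * dot u v.
Proof. by rewrite /dot -scalemxAl mxE. Qed.

Lemma dot_gt0 n (v : 'rV[R]_n) : v != 0 -> 0 < dot v v.
Proof.
move=> v0; rewrite lt_neqAle dotE sumr_ge0 ?andbT => [|k _]; last first.
  by rewrite -expr2 sqr_ge0.
apply: contra v0; rewrite eq_sym psumr_eq0 => [|k _]; last first.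
  by rewrite -expr2 sqr_ge0.
move=> /allP h; apply/eqP/rowP => k; rewrite mxE.
by have /h := mem_index_enum k; rewrite mulf_eq0 orbb => /eqP.
Qed.

Lemma enorm_neq0 n (v : 'rV[R]_n) : v != 0 -> enorm v != 0.
Proof. by move=> /dot_gt0 v0; rewrite /enorm gt_eqF // sqrtr_gt0. Qed.

Lemma dot3E u v :
  dot u v = u 0 0 * v 0 0 + u 0 1 * v 0 1 + u 0 2%:R * v 0 2%:R.
Proof.
rewrite dotE !big_ord_recl big_ord0 addr0 addrA.
by congr (u _ _ * v _ _ + u _ _ * v _ _ + u _ _ * v _ _); apply: val_inj.
Qed.

Lemma cross3E u v :
  (cross u v 0 0 = u 0 1 * v 0 2%:R - u 0 2%:R * v 0 1) *
  (cross u v 0 1 = u 0 2%:R * v 0 0 - u 0 0 * v 0 2%:R) *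
  (cross u v 0 2%:R = u 0 0 * v 0 1 - u 0 1 * v 0 0).
Proof.
by rewrite !mxE; split; [split|]; congr (u _ _ * v _ _ - u _ _ * v _ _);
  apply: val_inj.
Qed.

Lemma dot_cross u v w : dot u (cross v w) = dot (cross u v) w.
Proof. by rewrite !dot3E !cross3E; ring. Qed.

Lemma mulmx23E (u : 'rV[R]_2) (A : 'M[R]_(2, 3)) k :
  (u *m A) 0 k = u 0 0 * A 0 k + u 0 1 * A 1 k.
Proof.
rewrite mxE !big_ord_recl big_ord0 addr0.
by congr (u _ _ * A _ _ + u _ _ * A _ _); apply: val_inj.
Qed.

(* Lagrange's identity *)
Lemma det_gram (A : 'M[R]_(2, 3)) : \det (A *m A^T) =
  dot (cross (row 0 A) (row 1 A)) (cross (row 0 A) (row 1 A)).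
Proof.
have gramE i j : (A *m A^T) i j = dot (row i A) (row j A).
  by rewrite dotE mxE; apply: eq_bigr => k _; rewrite !mxE.
by rewrite det_mx22 !gramE !dot3E !cross3E; ring.
Qed.

Lemma dot_cross_cross (A : 'M[R]_(2, 3)) (u v : 'rV[R]_2) :
  dot (u *m A) (cross (cross (row 0 A) (row 1 A)) (v *m A)) =
  dot u (Defs.rot v) * \det (A *m A^T).
Proof.
rewrite det_gram (_ : dot u (Defs.rot v) = u 0 1 * v 0 0 - u 0 0 * v 0 1).
  by rewrite !(dot3E, cross3E) !mulmx23E !mxE; ring.
rewrite dotE !big_ord_recl big_ord0 !mxE /=.
have -> : lift ord0 ord0 = 1 :> 'I_2 by apply: val_inj.
have -> : ord0 = 0 :> 'I_2 by apply: val_inj.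
ring.
Qed.

Lemma mulmx_row_free_neq0 m n (A : 'M[R]_(m, n)) (v : 'rV[R]_m) :
  row_free A -> v != 0 -> v *m A != 0.
Proof.
by move=> /row_free_inj fA; apply: contra => /eqP vA; apply/eqP/fA;
  rewrite vA mul0mx.
Qed.

(** A kernel vector [v] of the Gram matrix would give [|v A|^2 = v A A^T v^T = 0], against row
    freeness; nonnegativity is Lagrange's identity. *)
Lemma det_gram_gt0 (A : 'M[R]_(2, 3)) : row_free A -> 0 < \det (A *m A^T).
Proof.
move=> fA; rewrite lt_neqAle det_gram; apply/andP; split; last first.
  by rewrite dotE sumr_ge0 // => k _; rewrite -expr2 sqr_ge0.
rewrite -det_gram eq_sym; apply/det0P => -[v v0 vG].
have := dot_gt0 _ _ (mulmx_row_free_neq0 _ _ _ _ fA v0).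
by rewrite /dot trmx_mul mulmxA -(mulmxA v) vG mul0mx mxE ltxx.
Qed.

Lemma cvg_dot n T (Fl : set_system T) (FF : Filter Fl) (l : 'rV[R]_n)
    (f : T -> 'rV[R]_n) (v : 'rV[R]_n) :
  f @ Fl --> v -> dot l (f h) @[h --> Fl] --> dot l v.
Proof.
move=> fv; rewrite dotE; under eq_fun do rewrite dotE.
have H k : f h 0 k @[h --> Fl] --> v 0 k.
  exact: (cvg_comp _ _ fv (coord_continuous (i := 0) (j := k) (x := v))).
elim: (index_enum _) => [|k s IH].
  by rewrite big_nil; under eq_fun do rewrite big_nil; exact: cvg_cst.
have -> : (fun h => \sum_(i <- k :: s) l 0 i * f h 0 i) =
    (fun h => l 0 k * f h 0 k) \+ (fun h => \sum_(i <- s) l 0 i * f h 0 i).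
  by apply/funext => h; rewrite big_cons.
by rewrite big_cons; apply: cvgD => //; apply: cvgM => //; exact: cvg_cst.
Qed.

(** * Chain rule and Piola map for a regular map *)

Section Piola.
Variable F : 'rV[R]_2 -> 'rV[R]_3.
Hypothesis regF : regular_map F.

Lemma regular_row_free x : ref_triangle x -> row_free ('J F x).
Proof. by case: regF => _ _ rk /rk; rewrite /row_free => ->. Qed.

Lemma regular_differentiable x : ref_triangle x -> differentiable F x.
Proof. by case: regF => -[U oU [TU /(_ [::]) sF]] _ _ /TU /sF. Qed.

Lemma regular_comp_derivable (g : R -> 'rV[R]_2) t :
  ref_triangle (g t) -> derivable g t 1 ->
  derivable (F \o g) t 1 /\ derive1 (F \o g) t = derive1 g t *m 'J F (g t).
Proof.
move=> /regular_differentiable dF /derivable1_diffP dg.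
have dFg : differentiable (F \o g) t by exact: differentiable_comp.
split; first exact/derivable1_diffP.
by rewrite !derive1E !deriveE // diff_comp //= -deriveE // deriveEjacobian.
Qed.

(** [J_Gamma] enters once through the Piola map and once through the unit normal, and the two
    inverses cancel [det G = J_Gamma^2]. *)
Lemma piola_flux (what : 'rV[R]_2 -> 'rV[R]_2) (w : 'rV[R]_3 -> 'rV[R]_3)
    x (v : 'rV[R]_2) :
  piola F what w -> ref_triangle x ->
  dot (w (F x)) (cross (unit_normal F x) (v *m 'J F x)) =
  dot (what x) (Defs.rot v).
Proof.
move=> pF Tx; have := det_gram_gt0 _ (regular_row_free _ Tx).
set D := \det _ => D0.
have crossZ (a : R) u z : cross (a *: u) z = a *: cross u z.
  by apply/rowP => k; rewrite !mxE; ring.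
rewrite pF // dotZl /unit_normal crossZ dotZr dot_cross_cross.
rewrite /area_density /metric -/D.
have sD0 : Num.sqrt D != 0 by rewrite gt_eqF // sqrtr_gt0.
by rewrite -{3}[D]sqr_sqrtr ?ltW //; field.
Qed.

End Piola.
End Vectors.

(** * Derivatives on [0, 1] and change of parameter along a curve *)

Section Curves.
Context {R : realType} {n : nat}.
Implicit Types (c p q : R -> 'rV[R]_n.+1) (l : 'rV[R]_n.+1) (s t : R).

(* Two-sided derivatives are tested on increments staying in [0, 1] only, so
   that the endpoints need no special treatment. *)
Definition unit_increments t : set_system R :=
  within [set h | 0 <= h + t <= 1] 0^'.

Lemma unit_increments_filter t : 0 <= t <= 1 -> ProperFilter (unit_increments t).
Proof.
move=> /andP[t0 t1]; split; last exact: within_filter.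
rewrite /unit_increments /within /= => /nbhs_ballP[e /= e0].
(* A nonzero increment staying in [0, 1]: forward from the left half, backward from the right half,
   by less than [e] and at most 1/2. *)
move=> /(_ (if t <= 2^-1 then Num.min (e / 2) 2^-1 else - Num.min (e / 2) 2^-1)).
have m0 : 0 < Num.min (e / 2) 2^-1 by rewrite lt_min; apply/andP; split; lra.
have m1 : Num.min (e / 2) 2^-1 <= 2^-1 by rewrite ge_min lexx orbT.
have m2 : Num.min (e / 2) 2^-1 < e by rewrite gt_min; apply/orP; left; lra.
move: (Num.min _ _) m0 m1 m2 => m m0 m1 m2; apply.
- by rewrite /ball /= sub0r; case: ifP => _; rewrite ?normrN gtr0_norm.
- by case: ifP => _; rewrite ?oppr_eq0 gt_eqF.
- by case: ifPn; rewrite -?ltNge => ?; lra.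
Qed.

Lemma cvg_derive1 c t : derivable c t 1 ->
  h^-1 *: (c (h + t) - c t) @[h --> 0^'] --> derive1 c t.
Proof.
have E : (fun h => h^-1 *: ((c \o shift t) (h *: 1) - c t)) =
    (fun h => h^-1 *: (c (h + t) - c t)).
  by apply/funext => h /=; rewrite /GRing.scale/= mulr1.
by rewrite /derivable E.
Qed.

Lemma cvg_derive1_unit c t : derivable c t 1 ->
  h^-1 *: (c (h + t) - c t) @[h --> unit_increments t] --> derive1 c t.
Proof. by move=> /cvg_derive1; exact: cvg_within_filter. Qed.

Lemma derivable_continuous c t : derivable c t 1 -> {for t, continuous c}.
Proof. by move=> /derivable1_diffP /differentiable_continuous. Qed.

(** A two-sided derivative is also the limit along increments that stay in [0, 1], even at an
    endpoint, and there the quotients coincide. *)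
Lemma derive1_eq_unit p q s : 0 <= s <= 1 ->
  (forall u, 0 <= u <= 1 -> p u = q u) ->
  derivable p s 1 -> derivable q s 1 -> derive1 p s = derive1 q s.
Proof.
move=> s01 pq /cvg_derive1_unit dp /cvg_derive1_unit dq.
have PF := unit_increments_filter _ s01.
have hT : hausdorff_space 'rV[R]_n.+1 := @norm_hausdorff _ _.
apply: (cvg_unique hT dp); apply: cvg_trans dq; apply: near_eq_cvg.
apply: filterS (withinT _ _) => h /= h01.
by rewrite !pq.
Qed.

(** A continuous injection of a compact interval has a continuous inverse on its image: [q] sends
    every cluster point of [phi] to [q s], so that point is [s], and compactness turns a unique
    cluster point into a limit. *)
Lemma lift_cvg {Fl : set_system R} {FF : ProperFilter Fl} q s (phi : R -> R) :
  0 <= s <= 1 ->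
  (forall u, 0 <= u <= 1 -> {for u, continuous q}) ->
  set_inj `[0, 1] q ->
  (\forall h \near Fl, 0 <= phi h <= 1) ->
  q (phi h) @[h --> Fl] --> q s ->
  phi @ Fl --> s.
Proof.
move=> s01 qc qi phi01 qphi.
have cluster_eq x : cluster (phi @ Fl) x -> x = s.
  move=> xcl; have x01 : 0 <= x <= 1.
    suff : closure `[0 : R, 1]%classic x.
      by rewrite -(closure_id _).1 ?in_itv //=; exact: itv_closed.
    move=> B Bx; apply: xcl Bx.
    by apply: filterS phi01 => h ?; rewrite /= in_itv.
  apply: qi; rewrite ?inE /= ?in_itv //; apply/esym.
  apply: (@norm_hausdorff _ 'rV[R]_n.+1) => U V Us Vx.
  have [] := xcl (q @^-1` U) (q @^-1` V); first exact: qphi.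
    exact: (qc x x01 V Vx).
  by move=> y [Uy Vy]; exists (q y).
have phiV (a b : R) : a <= 0 -> 1 <= b -> (phi @ Fl) `[a, b]%classic.
  move=> a0 b1; apply: filterS phi01 => h /= /andP[h0 h1].
  by rewrite in_itv /= (le_trans a0 h0) (le_trans h1 b1).
(* [-1, 2] is a compact neighbourhood of [s], which [0, 1] is not when [s] is an endpoint. *)
apply: (@compact_cluster_set1 _ s _ `[-1, 2]%classic (@Rhausdorff R)).
- exact: segment_compact.
- have : nbhs s `]-1, 2[%classic.
    apply: open_nbhs_nbhs; split; first exact: interval_open.
    by rewrite /= in_itv /=; apply/andP; case/andP: s01 => ? ?; split; lra.
  by apply: filterS => x; rewrite /= !in_itv /= => /andP[? ?]; rewrite !ltW.
- by apply: phiV; lra.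
- apply/seteqP; split => x; first exact: cluster_eq.
  move=> ->; have [y [_ ycl]] := @segment_compact R 0 1 _ _ (phiV _ _ (lexx _) (lexx _)).
  by rewrite -(cluster_eq _ ycl).
Qed.

(** The chain rule for the transition [phi], with [q (phi h) = c (h + t)], is avoided by comparing
    two quotients of one increment of [c]: by [h] and by [phi h - s]. *)
Lemma tangent_functional c q l s t :
  0 <= t <= 1 -> 0 <= s <= 1 ->
  (forall u, 0 <= u <= 1 -> {for u, continuous q}) ->
  set_inj `[0, 1] q -> set_inj `[0, 1] c ->
  c @` `[0, 1] `<=` q @` `[0, 1] -> c t = q s ->
  derivable c t 1 -> derivable q s 1 ->
  (derive1 q s : 'rV[R]_n.+1) != 0 ->
  dot l (derive1 q s) = 0 -> dot l (derive1 c t) = 0.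
Proof.
move=> t01 s01 qc qi ci cq cts dc dq q0 lq.
have PF := unit_increments_filter _ t01.
have in01 : \forall h \near unit_increments t, 0 <= h + t <= 1 by exact: withinT.
have nz : \forall h \near unit_increments t, h != 0.
  apply: cvg_within; exact: withinT.
have /choice[phi phiP] : forall h, exists u, 0 <= h + t <= 1 ->
    0 <= u <= 1 /\ q u = c (h + t).
  move=> h; have [h01|?] := boolP (0 <= h + t <= 1); last by exists 0.
  have [|u u01 qu] := cq (c (h + t)).
    by exists (h + t) => //=; rewrite in_itv.
  by exists u; move: u01; rewrite /= in_itv /=.
have phis : phi @ unit_increments t --> s.
  apply: (lift_cvg q) => //; first by apply: filterS in01 => h /phiP[].
  rewrite -cts.
  have : c (h + t) @[h --> unit_increments t] --> c t.
    apply: cvg_within_filter; apply: cvg_within_filter.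
    have cc := derivable_continuous _ _ dc.
    have ht : h + t @[h --> (0 : R)] --> t.
      by rewrite -[X in _ --> X]add0r; apply: cvgD; [exact: cvg_id|exact: cvg_cst].
    exact: (cvg_comp _ _ ht cc).
  apply: cvg_trans; apply: near_eq_cvg.
  by apply: filterS in01 => h /phiP[].
(* Division by [phi h - s] is safe: [phi h = s] would give [c (h + t) = c t], so [h = 0] by
   injectivity of [c]. *)
have ks : phi h - s @[h --> unit_increments t] --> (0 : R)^'.
  move=> A /= A0.
  have : (phi h - s) @[h --> unit_increments t] --> (0 : R).
    by rewrite -(subrr s); apply: cvgB => //; exact: cvg_cst.
  move=> /(_ _ A0) /=; rewrite /nbhs /=.
  move=> H; near=> h; apply: (near H h) => //.
  apply/eqP => /subr0_eq phihs.
  have h01 : 0 <= h + t <= 1 by near: h.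
  have [_] := phiP _ h01; rewrite phihs -cts => /ci.
  rewrite !inE /= !in_itv => /(_ t01 h01) tht.
  have : h != 0 by near: h.
  by rewrite (_ : h = 0) ?eqxx //; lra.
have quot m : dot m ((phi h - s)^-1 *: (c (h + t) - c t)) @[h --> unit_increments t] -->
    dot m (derive1 q s).
  apply: (cvg_dot _ _ _ PF).
  have := cvg_comp _ _ ks (cvg_derive1 _ _ dq).
  apply: cvg_trans; apply: near_eq_cvg.
  apply: filterS in01 => h /phiP[_ qphi] /=.
  by rewrite subrK qphi cts.
have cquot m : dot m (h^-1 *: (c (h + t) - c t)) @[h --> unit_increments t] -->
    dot m (derive1 c t).
  by apply: (cvg_dot _ _ _ PF); exact: cvg_derive1_unit.
(* Swapping the two scalar quotients between the factors [l] and [tau] changes nothing, so in the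
   limit [(l . c') (tau . q') = (l . q') (tau . c') = 0]. For [tau = q'] the factor [tau . q'] is
   positive. *)
pose tau : 'rV[R]_n.+1 := derive1 q s.
have tau0 := dot_gt0 _ tau q0.
have FF : Filter (unit_increments t) by exact: within_filter.
have := @cvgM _ _ _ FF _ _ _ _ (quot l) (cquot tau).
have := @cvgM _ _ _ FF _ _ _ _ (cquot l) (quot tau).
have -> : (fun h => dot l (h^-1 *: (c (h + t) - c t))) \*
    (fun h => dot tau ((phi h - s)^-1 *: (c (h + t) - c t))) =
   (fun h => dot l ((phi h - s)^-1 *: (c (h + t) - c t))) \*
    (fun h => dot tau (h^-1 *: (c (h + t) - c t))).
  by apply/funext => h /=; rewrite !dotZr; ring.
move=> c1 /(cvg_unique (@Rhausdorff R) c1) e.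
have : dot l (derive1 c t) * dot tau tau = 0 by rewrite [LHS]e lq mul0r.
move: (dot tau tau) tau0 => r r0 /eqP.
by rewrite mulf_eq0 (gt_eqF r0) orbF => /eqP.
Unshelve. all: by end_near.
Qed.

End Curves.

(** * Bernstein expansions of edge fluxes *)

Section Bernstein.
Context {R : realType}.
Implicit Types (f g : R -> R) (t : R).

(** Forms of degree [m] in [t] and [1 - t], that is, Bernstein expansions without the binomial
    factors. Indexing the coefficients by [nat] allows shifts without ordinal casts. *)
Definition homogeneous m f := exists c : nat -> R, forall t,
  f t = \sum_(j < m.+1) c j * (t ^+ j * (1 - t) ^+ (m - j)).

Lemma homogeneous0 m : homogeneous m (fun=> 0).
Proof. by exists (fun=> 0) => t; rewrite big1 // => j _; rewrite mul0r. Qed.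

Lemma homogeneousD m f g :
  homogeneous m f -> homogeneous m g -> homogeneous m (fun t => f t + g t).
Proof.
move=> [a fa] [b gb]; exists (fun j => a j + b j) => t.
by rewrite fa gb -big_split; apply: eq_bigr => j _; rewrite mulrDl.
Qed.

Lemma homogeneousZ m a f : homogeneous m f -> homogeneous m (fun t => a * f t).
Proof.
move=> [c fc]; exists (fun j => a * c j) => t.
by rewrite fc mulr_sumr; apply: eq_bigr => j _; rewrite mulrA.
Qed.

Lemma homogeneous_sum m (J : Type) (r : seq J) (P : pred J) (f : J -> R -> R) :
  (forall j, P j -> homogeneous m (f j)) ->
  homogeneous m (fun t => \sum_(j <- r | P j) f j t).
Proof.
move=> hf; elim: r => [|j r IH].
  rewrite (_ : (fun t => _) = (fun=> 0)); first exact: homogeneous0.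
  by apply/funext => t; rewrite big_nil.
case: (boolP (P j)) => Pj.
  rewrite (_ : (fun t => _) = (fun t => f j t + \sum_(i <- r | P i) f i t)).
    by apply: homogeneousD => //; exact: hf.
  by apply/funext => t; rewrite big_cons Pj.
rewrite (_ : (fun t => _) = (fun t => \sum_(i <- r | P i) f i t)) //.
by apply/funext => t; rewrite big_cons (negbTE Pj).
Qed.

(* The factor is the linear form [a t + b (1 - t)]; every affine function
   of [t] is one, in particular 1 for [a = b = 1]. *)
Lemma homogeneousM m a b f : homogeneous m f ->
  homogeneous m.+1 (fun t => (b + t * (a - b)) * f t).
Proof.
move=> [c fc].
have -> : (fun t => (b + t * (a - b)) * f t) =
    (fun t => a * (t * f t) + b * ((1 - t) * f t)) by apply/funext => t; ring.
apply: homogeneousD; apply: homogeneousZ.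
  (* Multiplication by [t] shifts the coefficients up, with 0 entering at the bottom. *)
  exists (fun j => if j is j'.+1 then c j' else 0) => t.
  rewrite big_ord_recl /= mul0r add0r fc mulr_sumr; apply: eq_bigr => j _.
  by rewrite /bump /= add1n subSS exprS; ring.
(* Multiplication by [1 - t] keeps the indices; the new top coefficient is 0. *)
exists (fun j => if (j <= m)%N then c j else 0) => t.
rewrite big_ord_recr /= ltnn mul0r addr0 fc mulr_sumr; apply: eq_bigr => j _.
have jm : (j <= m)%N by rewrite -ltnS.
by rewrite jm subSn // exprS; ring.
Qed.

(** Each of the [i + j] affine factors contributes one degree; the missing [d - (i + j)] come from
    factors [1 = t + (1 - t)]. *)
Lemma homogeneous_monomial d i j x0 x1 y0 y1 : (i + j <= d)%N ->
  homogeneous d (fun t => (x0 + t * x1) ^+ i * (y0 + t * y1) ^+ j).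
Proof.
move=> ijd; rewrite -(subnK ijd); move: (d - _)%N => k.
elim: k => [|k IH].
  elim: i {ijd} => [|i IH].
    elim: j => [|j IH].
      by exists (fun=> 1) => t; rewrite big_ord1; ring.
    (* The coefficients of the linear form are the values of [y0 + t * y1] at 1 and 0. *)
    have := @homogeneousM _ (y1 + y0) y0 _ IH; congr homogeneous.
    by apply/funext => t; rewrite exprS; ring.
  have := @homogeneousM _ (x1 + x0) x0 _ IH; congr homogeneous.
  by apply/funext => t; rewrite exprS; ring.
have := @homogeneousM _ 1 1 _ IH; congr homogeneous.
by apply/funext => t; ring.
Qed.

Lemma homogeneous_bernstein d f : homogeneous d f ->
  exists c : 'rV[R]_d.+1, forall t, f t = \sum_(j < d.+1) c 0 j * bernstein d j t.
Proof.
move=> [c fc]; exists (\row_j (c j / 'C(d, j)%:R)) => t.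
rewrite fc; apply: eq_bigr => j _; rewrite mxE /bernstein -!mulrA mulKf //.
by rewrite pnatr_eq0 -lt0n bin_gt0 -ltnS.
Qed.

(** An existing expansion makes [get] return a valid one. Agreement is asked on [0, 1] only, since
    the fields are known to be polynomial only on the triangle. *)
Lemma bernstein_coefP d f : (exists2 h, homogeneous d h &
    forall t, 0 <= t <= 1 -> f t = h t) ->
  forall t, 0 <= t <= 1 ->
    f t = \sum_(j < d.+1) bernstein_coef d f 0 j * bernstein d j t.
Proof.
move=> [h /homogeneous_bernstein[c hc] fh].
apply: (@getPex _ [set c : 'rV[R]_d.+1 | forall t, 0 <= t <= 1 ->
    f t = \sum_(j < d.+1) c 0 j * bernstein d j t]).
by exists c => t t01; rewrite fh.
Qed.

Lemma is_derive_affine n (p v : 'rV[R]_n.+1) t :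
  is_derive t 1 (fun t => p + t *: v) v.
Proof.
have dv : is_derive t (1 : R) ( *:%R ^~ v) v.
  apply: DeriveDef; first exact/derivable1_diffP.
  by rewrite deriveE // diff_val scale1r.
by rewrite -[X in is_derive _ _ _ X]add0r; exact: is_deriveD.
Qed.

(** Along an affine edge the coordinates are affine in [t] and the rotated velocity is constant, so
    the degree stays at most [d]. *)
Lemma ref_flux_homogeneous d what (g : R -> 'rV[R]_2) E :
  poly_field d what -> affine_param g E -> E `<=` ref_triangle ->
  exists2 h, homogeneous d h &
    forall t, 0 <= t <= 1 -> ref_flux what g t = h t.
Proof.
move=> [a whatE] [[p [v gE]] gim] ET.
exists (fun t => \sum_(i < d.+1) \sum_(j < d.+1 | (i + j <= d)%N)
  dot (a i j) (Defs.rot v) *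
  ((p 0 0 + t * v 0 0) ^+ i * (p 0 1 + t * v 0 1) ^+ j)).
  apply: homogeneous_sum => i _; apply: homogeneous_sum => j ijd.
  exact/homogeneousZ/homogeneous_monomial.
move=> t t01; rewrite /ref_flux /ref_conormal.
have -> : derive1 g t = v.
  have -> : g = (fun t => p + t *: v) by apply/funext.
  by rewrite derive1E (@derive_val _ _ _ _ _ _ _ (is_derive_affine _ p v t)).
rewrite whatE; last first.
  by apply: ET; rewrite -gim; exists t => //=; rewrite in_itv.
rewrite /dot !mulmx_suml summxE; apply: eq_bigr => i _.
rewrite mulmx_suml summxE; apply: eq_bigr => j _.
by rewrite -scalemxAl gE !mxE mulrC.
Qed.

Lemma normal_functional_flux d (uhat vhat : 'rV[R]_2 -> 'rV[R]_2)
    (g h : R -> 'rV[R]_2) (E E' : set 'rV[R]_2) :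
  poly_field d uhat -> affine_param g E -> E `<=` ref_triangle ->
  poly_field d vhat -> affine_param h E' -> E' `<=` ref_triangle ->
  (forall k : 'I_d.+1, normal_functional uhat g vhat h k = 0) ->
  forall t, 0 <= t <= 1 -> ref_flux uhat g t = ref_flux vhat h t.
Proof.
move=> pu ga ET pv ha ET' zero t t01.
have eu := bernstein_coefP _ _ (ref_flux_homogeneous _ _ _ _ pu ga ET) _ t01.
have ev := bernstein_coefP _ _ (ref_flux_homogeneous _ _ _ _ pv ha ET') _ t01.
have coefE : bernstein_coef d (ref_flux uhat g) =
    bernstein_coef d (ref_flux vhat h).
  apply/rowP => k; have := zero k; rewrite /normal_functional => /eqP.
  by rewrite subr_eq0 => /eqP.
move: eu; rewrite coefE => {}eu.
exact: etrans eu (esym ev).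
Qed.

End Bernstein.

(** * Flux on one edge and across a shared edge *)

Section Edges.
Context {R : realType}.

(** The speed undoes the normalization of the tangent in [conormal]; it is nonzero because [g] is
    regular and [J] is injective. *)
Lemma piola_edge_flux (F : 'rV[R]_2 -> 'rV[R]_3) (w : 'rV[R]_3 -> 'rV[R]_3)
    (what : 'rV[R]_2 -> 'rV[R]_2) (a : 'I_3) (g : R -> 'rV[R]_2) t :
  regular_map F -> piola F what w -> regular_param g (ref_edge a) ->
  0 <= t <= 1 ->
  dot (w (F (g t))) (conormal (unit_normal F (g t)) (F \o g) t) *
    speed (F \o g) t =
  dot (what (g t)) (ref_conormal g t).
Proof.
move=> regF pF [[gE _ _] dg _] t01; have [dgt g0] := dg t t01.
have Tx : ref_triangle (g t) by case: (gE t) => //=; rewrite in_itv.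
have [_ dFg] := regular_comp_derivable _ regF _ _ Tx dgt.
have s0 : speed (F \o g) t != 0.
  rewrite /speed dFg enorm_neq0 // mulmx_row_free_neq0 //.
  exact: regular_row_free.
rewrite /conormal /unit_tangent dot_cross dotZr -dot_cross dFg
  (piola_flux _ regF _ _ _ _ pF Tx).
by rewrite mulrC mulVKf.
Qed.

Lemma matched_flux_eq (F G : 'rV[R]_2 -> 'rV[R]_3) (n : 'rV[R]_3 -> 'rV[R]_3)
    Gamma (u v : 'rV[R]_3 -> 'rV[R]_3) (uhat vhat : 'rV[R]_2 -> 'rV[R]_2)
    (a b : 'I_3) (g h : R -> 'rV[R]_2) (c : R -> 'rV[R]_3) t x y :
  curved_triangle Gamma n F -> curved_triangle Gamma n G ->
  piola F uhat u -> piola G vhat v ->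
  affine_param g (ref_edge a) -> affine_param h (ref_edge b) ->
  (forall s, 0 <= s <= 1 -> F (g s) = G (h s)) ->
  (forall s, 0 <= s <= 1 -> ref_flux uhat g s = ref_flux vhat h s) ->
  regular_param c (F @` ref_edge a) ->
  0 <= t <= 1 -> ref_edge a x -> ref_edge b y -> F x = c t -> G y = c t ->
  dot (u (c t)) (conormal (unit_normal F x) c t) =
  dot (v (c t)) (conormal (unit_normal G y) c t).
Proof.
move=> [regF _ nF] [regG _ nG] pF pG gaff haff FG flux [[cE ci _] dc _] t01.
move=> xa yb Fx Gy.
have [[p [z gE]] gim] := gaff; have [[p' [z' hE]] him] := haff.
have gz : g = (fun s => p + s *: z) by apply/funext.
have hz : h = (fun s => p' + s *: z') by apply/funext.
have dg s := is_derive_affine _ p z s; have dh s := is_derive_affine _ p' z' s.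
rewrite -gz in dg; rewrite -hz in dh.
have gT s : 0 <= s <= 1 -> ref_edge a (g s).
  by move=> s01; rewrite -gim; exists s => //=; rewrite in_itv.
have hT s : 0 <= s <= 1 -> ref_edge b (h s).
  by move=> s01; rewrite -him; exists s => //=; rewrite in_itv.
move: (xa); rewrite -{1}gim => -[s /=]; rewrite in_itv /= => s01 gsx.
have Tx : ref_triangle x by case: xa.
have Ty : ref_triangle y by case: yb.
(* [G] maps both points to [c t], so its injectivity puts [y] at the same parameter [s] as [x]. *)
have hsy : h s = y.
  have [_ Ginj _] := regG; apply: Ginj; rewrite ?inE //; first by case: (hT s s01).
  by rewrite -FG // gsx Fx.
(* A zero velocity would shrink the physical edge to the point [F p], against injectivity of [c]. *)
have z0 : z != 0.
  apply/eqP => z0; have cst r : 0 <= r <= 1 -> c r = F p.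
    move=> r01; have /cE : `[0, 1]%classic r by rewrite /= in_itv.
    by rewrite -gim => -[_ [r' _ <-] <-]; rewrite gE z0 scaler0 addr0.
  have c01 : c 0 = c 1 by rewrite !cst ?lexx ?ler01.
  move: c01 => /ci; rewrite !inE /= !in_itv /= !lexx !ler01 => /(_ isT isT) /eqP.
  by rewrite eq_sym oner_eq0.
have dFg r : 0 <= r <= 1 -> derivable (F \o g) r 1 /\
    derive1 (F \o g) r = z *m 'J F (g r).
  move=> /gT[Tr _]; have dgr : derivable g r 1 by [].
  have [d1 ->] := regular_comp_derivable _ regF g r Tr dgr.
  by split => //; rewrite derive1E derive_val.
have dGh r : 0 <= r <= 1 -> derivable (G \o h) r 1 /\
    derive1 (G \o h) r = z' *m 'J G (h r).
  move=> /hT[Tr _]; have dhr : derivable h r 1 by [].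
  have [d1 ->] := regular_comp_derivable _ regG h r Tr dhr.
  by split => //; rewrite derive1E derive_val.
have [dFgs dFgsE] := dFg s s01; have [dGhs dGhsE] := dGh s s01.
have dFG : derive1 (F \o g) s = derive1 (G \o h) s.
  exact: derive1_eq_unit.
have nxy : unit_normal G y = unit_normal F x by rewrite nF // nG // Fx Gy.
(* Cyclicity of the triple product turns the flux jump into a pairing of the velocity with a fixed
   vector, the form [tangent_functional] needs. *)
have kill : dot (cross (u (c t) - v (c t)) (unit_normal F x))
    (derive1 (F \o g) s) = 0.
  rewrite -dot_cross dotBl {2}dFG -{2}nxy dFgsE dGhsE gsx hsy -{1}Fx -Gy.
  rewrite (piola_flux _ regF _ _ _ _ pF Tx) (piola_flux _ regG _ _ _ _ pG Ty).
  apply/eqP; rewrite subr_eq0; apply/eqP.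
  have := flux s s01; rewrite /ref_flux /ref_conormal !derive1E.
  by rewrite (@derive_val _ _ _ _ _ _ _ (dg s)) (@derive_val _ _ _ _ _ _ _ (dh s)) gsx hsy.
have qc r : 0 <= r <= 1 -> {for r, continuous (F \o g)}.
  by move=> /dFg[d1 _]; exact: derivable_continuous.
have qi : set_inj `[0, 1] (F \o g).
  move=> r r'; rewrite !inE /= !in_itv /= => r01 r'01.
  have [_ Finj _] := regF.
  move=> /Finj; rewrite !inE => /(_ (proj1 (gT r r01)) (proj1 (gT r' r'01))).
  rewrite !gE => /addrI /eqP; rewrite -subr_eq0 -scalerBl scaler_eq0 (negbTE z0).
  by rewrite orbF subr_eq0 => /eqP.
have cq : c @` `[0, 1] `<=` (F \o g) @` `[0, 1].
  move=> _ [r r01 <-]; have [e ea <-] := cE r r01.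
  by move: ea; rewrite -gim => -[r' r'01 <-]; exists r'.
have cts : c t = (F \o g) s by rewrite /= gsx Fx.
have q0 : (derive1 (F \o g) s : 'rV[R]_3) != 0.
  by rewrite dFgsE gsx; exact: mulmx_row_free_neq0 (regular_row_free _ regF _ Tx) z0.
have [dct _] := dc t t01.
have ceq := tangent_functional c (F \o g) _ s t t01 s01 qc qi ci cq cts dct dFgs
  q0 kill.
move: ceq; rewrite -dot_cross dotBl => /subr0_eq ceq.
(* Both fluxes carry the same factor, the inverse speed of [c], so equality for the velocity of [c]
   is enough. *)
by rewrite nxy /conormal /unit_tangent !dot_cross !dotZr -!dot_cross ceq.
Qed.

End Edges.

Theorem theorem7p2 (R : realType) (Gamma : set 'rV[R]_3)
    (n : 'rV[R]_3 -> 'rV[R]_3)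
    (hS : smooth_surface Gamma) (hn : orientation_normal Gamma n) :
  (forall (F : 'rV[R]_2 -> 'rV[R]_3) (w : 'rV[R]_3 -> 'rV[R]_3)
      (what : 'rV[R]_2 -> 'rV[R]_2),
    curved_triangle Gamma n F ->
    tangent_field Gamma (F @` ref_triangle) w ->
    piola F what w ->
    forall (a : 'I_3) (g : R -> 'rV[R]_2), regular_param g (ref_edge a) ->
    forall t : R, 0 <= t <= 1 ->
      dot (w (F (g t))) (conormal (unit_normal F (g t)) (F \o g) t) *
        speed (F \o g) t =
      dot (what (g t)) (ref_conormal g t)) /\
  (forall (I : finType) (F : I -> 'rV[R]_2 -> 'rV[R]_3)
      (gp gm : I -> 'I_3 -> I -> 'I_3 -> R -> 'rV[R]_2)
      (d : nat) (what : I -> 'rV[R]_2 -> 'rV[R]_2)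
      (w : I -> 'rV[R]_3 -> 'rV[R]_3),
    conforming_triangulation F Gamma n gp gm ->
    (forall i, poly_field d (what i)) ->
    (forall i, piola (F i) (what i) (w i)) ->
    (forall i a j b, shared_edge F i a j b -> forall k : 'I_d.+1,
      normal_functional (what i) (gp i a j b) (what j) (gm i a j b) k = 0) ->
    hdiv_conforming F w).
Proof.
split=> [F w what [regF _ _] _ pF a g reg_g t t01|].
  exact: (piola_edge_flux _ _ _ a).
move=> I F gp gm d what w [tri _ edges] pol pF zero i a j b sh c reg_c t x y.
move=> t01 xa yb Fx Fy; have [gaff haff match_] := edges i a j b sh.
have edgeT k : @ref_edge R k `<=` ref_triangle by move=> z [].
have flux := normal_functional_flux _ _ _ _ _ _ _ (pol i) gaff (edgeT a)
  (pol j) haff (edgeT b) (zero i a j b sh).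
exact: (matched_flux_eq _ _ _ _ _ _ _ _ _ _ _ _ _ _ _ _
  (tri i) (tri j) (pF i) (pF j) gaff haff match_ flux reg_c t01 xa yb Fx Fy).
Qed.
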